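(* Let $(v(n))_{n\ge0}$ be the integer sequence defined by $v(0)=1$ and $$v(n)=2^{n-1}\prod_{j=1}^n(4j-3)^2-\frac12\sum_{m=1}^{n-1}\binom{2n}{2m}v(m)v(n-m)\quad(n\ge1).$$ Then, given an odd prime $p$ and a positive integer $e\ge2$, the number $v(n)$ is divisible by $p^e$ for all $n\ge\left\lceil\frac{(e-1)p^2}{2}\right\rceil$. *)

(* Defs.v *)
From mathcomp Require Import all_boot all_order all_algebra.
From mathcomp Require Import zify ring.

Set Implicit Arguments.
Unset Strict Implicit.
Unset Printing Implicit Defensive.

Import Order.TTheory GRing.Theory Num.Theory.
Local Open Scope ring_scope.

(* The recurrence is an identity in [rat] because of the factor 1/2;
   [is_vseq_exists] and [is_vseq_unique] below show that it does determine
   exactly one integer sequence. *)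
Definition is_vseq (v : nat -> int) : Prop :=
  v 0%N = 1 /\
  forall n : nat, (1 <= n)%N ->
    (v n)%:Q = 2 ^+ (n - 1) * \prod_(1 <= j < n.+1) (4 * j%:R - 3) ^+ 2
      - 1 / 2 * \sum_(1 <= m < n)
                  'C(2 * n, 2 * m)%:R * (v m)%:Q * (v (n - m)%N)%:Q.

Lemma is_vseq_unique (v w : nat -> int) : is_vseq v -> is_vseq w -> v =1 w.
Proof.
move=> [v0 vr] [w0 wr]; elim/ltn_ind => -[|n] IH; first by rewrite v0 w0.
apply: (@intr_inj rat); rewrite vr // wr //; congr (_ - _ * _).
by apply: eq_big_nat => m /andP[m0 mn]; rewrite !IH //; lia.
Qed.

Lemma dvd2_bin_mid k : (0 < k)%N -> (2 %| 'C(k + k, k))%N.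
Proof.
case: k => // k _; rewrite addSn binS.
have -> : 'C(k + k.+1, k.+1) = 'C(k + k.+1, k).
  by rewrite -[RHS]bin_sub; [congr 'C(_, _); lia | lia].
by rewrite addnn -muln2 dvdn_mull.
Qed.

Definition conv_term (s : nat -> int) (n m : nat) : int :=
  ('C(2 * n, 2 * m))%:Z * s m * s (n - m)%N.

(* The terms with m and n - m agree, and the middle one is even. *)
Lemma dvd2_conv (s : nat -> int) n :
  (2%:Z %| (\sum_(1 <= m < n) conv_term s n m))%Z.
Proof.
have FE m : (m <= n)%N -> conv_term s n (n - m)%N = conv_term s n m.
  move=> mn; rewrite /conv_term subKn // mulnBr bin_sub ?leq_mul //.
  by rewrite mulrAC.
rewrite (bigID (fun m => m == n - m :> nat)%N) /=; apply: rpredD.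
  rewrite big_nat_cond; apply: rpred_sum => m /andP[/andP[m0 mn] /eqP me].
  rewrite /conv_term -mulrA; apply: dvdz_mulr.
  have -> : (2 * n = 2 * m + 2 * m)%N by lia.
  by rewrite dvdzE /= dvd2_bin_mid //; lia.
rewrite (bigID (fun m => m < n - m)%N) /=.
set A := (X in X + _); set B := (X in _ + X).
have -> : B = A.
  rewrite /A /B big_nat_rev big_nat_cond [RHS]big_nat_cond /=.
  apply: eq_big => m.
    by apply/idP/idP; lia.
  move=> /andP[/andP[m0 mn] _].
  by rewrite -[RHS]FE; [congr conv_term; lia | lia].
by rewrite -mulr2n -mulr_natl; apply: dvdz_mulr.
Qed.

Definition vseq_next (s : nat -> int) (n : nat) : int :=
  2 ^+ (n - 1) * \prod_(1 <= j < n.+1) (4 * j%:R - 3) ^+ 2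
  - ((\sum_(1 <= m < n) conv_term s n m)%R %/ 2%:Z)%Z.

Fixpoint vseq_prefix (n : nat) : seq int :=
  if n is n'.+1 then
    rcons (vseq_prefix n') (vseq_next (nth 0 (vseq_prefix n')) n)
  else [:: 1].

Definition vseq (n : nat) : int := nth 0 (vseq_prefix n) n.

Lemma is_vseq_exists : is_vseq vseq.
Proof.
have sz n : size (vseq_prefix n) = n.+1.
  by elim: n => //= n IH; rewrite size_rcons IH.
have nthE n k : (k <= n)%N -> nth 0 (vseq_prefix n) k = vseq k.
  elim: n => [|n IH]; first by case: k.
  rewrite leq_eqVlt => /orP[/eqP-> //|kn].
  by rewrite /= nth_rcons sz kn IH.
split=> // -[//|n] _.
have -> : vseq n.+1 = vseq_next vseq n.+1.
  rewrite /vseq /= nth_rcons sz ltnn eqxx /vseq_next; congr (_ - (_ %/ _)%Z).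
  by apply: eq_big_nat => m /andP[m0 mn]; rewrite /conv_term !nthE //; lia.
rewrite /vseq_next rmorphB /= rmorphM /= rmorphXn /= rmorph_prod /=.
congr (_ * _ - _).
  by apply: eq_bigr => j _; rewrite rmorphXn /= rmorphB /= rmorphM /= !rmorph_nat.
have /dvdzP[q qE] := dvd2_conv vseq n.+1.
rewrite qE mulzK //.
have : ((\sum_(1 <= m < n.+1) conv_term vseq n.+1 m)%:~R : rat) = (q * 2)%:~R.
  by rewrite qE.
rewrite rmorph_sum /= => E.
under eq_bigr => m _ do rewrite -[_%:R](rmorph_nat intr) -!rmorphM /= natz.
by rewrite E rmorphM /=; field.
Qed.

(* Main.v *)
Require Import Defs.
From mathcomp Require Import all_boot all_order all_algebra.
From mathcomp Require Import zify ring.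
Import Order.TTheory GRing.Theory Num.Theory.
Local Open Scope ring_scope.

(** Dividing the recurrence by (2n)! turns it into a square: the series
    V = \sum_n v(n) t^(2n) / (2n)! satisfies V^2 = F, where
    F = \sum_n a(n) t^(2n) / (2n)! and a(n) = 2^n \prod_(j <= n) (4j-3)^2
    ([is_vseq_double] is the coefficient of this identity at t^(2n)).
    So the p-adic size of v(n) / (2n)! is governed by that of a(n) / (2n)!.

    For odd p, an arithmetic progression of length m whose step is prime to p
    has a product at least as divisible by p as m!
    ([dvdn_prod_progression]), so the valuation of a(m) / (2m)! is at least
    minus that of the central binomial coefficient 'C(2m, m).  By Legendre's
    formula the latter is at most the number of powers of p in [p, 2m]
    ([logn_fact_double]), and this number is at most 2m / (p+1)
    ([trunc_log_even_le]): the first power costs p + 1 rather than p because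
    2m is even and p is odd.  A bound that is linear in m passes from F to its
    square root, since it is superadditive along products; hence v(n) / (2n)!
    has valuation at least - 2n / (p+1) ([logn_fact_dvd_vseq]).

    Finally (2n)! has valuation at least 2n / p + 2n / p^2 (integer parts).
    As soon as 2n >= p^2, the integer part of 2n / p exceeds that of
    2n / (p+1) ([logn_fact_lower]), so v(n) has valuation larger than the
    integer part of 2n / p^2, which is at least e - 1. *)

(** The quotient is a binomial coefficient. *)
Lemma dvdn_fact_rising (x m : nat) : (m`! %| \prod_(i < m) (x + i))%N.
Proof.
have -> : (\prod_(i < m) (x + i) = (x + m).-1 ^_ m)%N.
  rewrite ffact_prod (reindex_inj rev_ord_inj) /=.
  by apply: eq_bigr => i _; have := ltn_ord i; lia.
by rewrite -bin_ffact dvdn_mull.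
Qed.

(** Multiplying every factor by an inverse D of d modulo q changes the
    progression a + d * i into D * a + i, a product of m consecutive integers. *)
Lemma dvdn_prod_progression (q a d m : nat) :
  coprime d q -> (q %| m`!)%N -> (q %| \prod_(i < m) (a + d * i))%N.
Proof.
move=> cdq qm; case: d cdq => [|d] cdq.
  by move: cdq; rewrite /coprime gcd0n => /eqP ->.
have [D k DE _] := egcdnP q (ltn0Sn d).
move: DE; rewrite (eqP cdq) => DE.
have : coprime (D * d.+1) q.
  by rewrite DE coprime_sym /coprime gcdnMDl gcdn1.
rewrite coprimeMl => /andP[cDq _].
rewrite -(@Gauss_dvdr q (D ^ m)%N); last first.
  by rewrite coprime_sym coprimeXl.
have -> : (D ^ m * \prod_(i < m) (a + d.+1 * i)
           = \prod_(i < m) (D * (a + d.+1 * i)))%N.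
  by rewrite big_split /= prod_nat_const card_ord.
have E : (\prod_(i < m) (D * (a + d.+1 * i))
          = \prod_(i < m) (D * a + i) %[mod q])%N.
  apply: (big_rec2 (fun x y => x = y %[mod q])%N) => // i x y _ xy.
  rewrite -modnMm xy modnMm -modnMml -[RHS]modnMml; congr (_ * _ %% _)%N.
  by rewrite mulnDr mulnA DE mulnDl mul1n addnCA mulnAC modnMDl.
by rewrite /dvdn E -/(dvdn _ _) (dvdn_trans qm) ?dvdn_fact_rising.
Qed.

(** Legendre's formula for the two factorials, compared term by term: the k-th
    terms differ by (2m / p^k) - 2 (m / p^k), which is 0 or 1, and is 0 once
    p^k > 2m. *)
Lemma logn_fact_double (p m : nat) : prime p ->
  (logn p (2 * m)`! <= 2 * logn p m`! + trunc_log p (2 * m))%N.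
Proof.
move=> pp; have p1 := prime_gt1 pp; set T := trunc_log p _.
(* Padding with zero terms puts both Legendre sums on the same range. *)
have ex : (logn p m`! = \sum_(1 <= k < (2 * m).+1) m %/ p ^ k)%N.
  rewrite logn_fact // [RHS](big_cat_nat (n := m.+1)) //=; last lia.
  rewrite [X in (_ + X)%N]big_nat_cond [X in (_ + X)%N]big1 ?addn0 //.
  move=> k /andP[/andP[mk _] _].
  by rewrite divn_small // (ltn_trans mk) // ltn_expl.
have cntT n : (\sum_(1 <= k < n.+1) (k <= T) <= T)%N.
  elim: n => [|n IH]; first by rewrite big_nil.
  have [Tn|nT] := ltnP T n.+1.
    by rewrite big_nat_recr //= [(n.+1 <= T)%N]leqNgt Tn addn0.
  apply: leq_trans (_ : \sum_(1 <= k < n.+2) 1 <= T)%N.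
    by apply: leq_sum => k _; case: (k <= T)%N.
  by rewrite sum_nat_const_nat; lia.
apply: leq_trans (leq_add (leqnn _) (cntT (2 * m)%N)).
rewrite ex logn_fact // big_distrr -big_split /=.
apply: leq_sum => k _.
have [kT|Tk] := leqP k T.
  have pk : (0 < p ^ k)%N by rewrite expn_gt0 (prime_gt0 pp).
  have := divn_eq m (p ^ k); have := ltn_pmod m pk.
  set r := (m %% _)%N; set q := (m %/ _)%N => rp mE.
  rewrite -ltnS ltn_divLR //; nia.
by rewrite divn_small // (leq_trans (trunc_log_ltn _ p1)) // leq_exp2l.
Qed.

(** If p^T <= 2m then T * (p+1) <= 2m.  For T >= 2 this follows from
    T * (p+1) <= p^T; for T = 1 it amounts to 2m <> p, which is where the
    parity of p enters. *)
Lemma trunc_log_even_le (p m : nat) : (2 < p)%N -> odd p ->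
  (trunc_log p (2 * m) <= (2 * m) %/ p.+1)%N.
Proof.
move=> p2 po; rewrite leq_divRL //.
case: m => [|m]; first by rewrite muln0 trunc_log0.
have p1 : (1 < p)%N by lia.
have := @trunc_logP p (2 * m.+1) p1 isT; set T := trunc_log _ _.
case: T => [|[|T]] //; first by rewrite expn1; lia.
apply: leq_trans.
elim: T => [|T IH]; first by rewrite expnS expn1; nia.
rewrite expnS; move: IH; set X := (p ^ _)%N; nia.
Qed.

(** The recurrence with denominators cleared: the terms m = 0 and m = n of the
    convolution of v with itself account for 2 * v n. *)
Lemma is_vseq_double (v : nat -> int) (n : nat) : is_vseq v -> (1 <= n)%N ->
  2 * v n = (2 ^ n * (\prod_(i < n) (1 + 4 * i)) ^ 2)%N%:Z
            - \sum_(1 <= m < n) conv_term v n m.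
Proof.
move=> hv n1; apply: (@intr_inj rat); rewrite rmorphM /= hv.2 // rmorphB /=.
have -> : (\sum_(1 <= m < n) 'C(2 * n, 2 * m)%:R * (v m)%:Q * (v (n - m)%N)%:Q
  = (\sum_(1 <= m < n) conv_term v n m)%:~R).
  rewrite rmorph_sum; apply: eq_bigr => m _.
  by rewrite /conv_term !rmorphM /= -pmulrn.
have -> : ((2 ^ n * (\prod_(i < n) (1 + 4 * i)) ^ 2)%N%:Z%:~R : rat)
  = 2 * (2 ^+ (n - 1) * \prod_(1 <= j < n.+1) (4 * j%:R - 3) ^+ 2).
  rewrite -pmulrn natrM !natrX mulrA -exprS subn1 prednK //; congr (_ * _).
  rewrite big_add1 big_mkord prodrXl natr_prod; congr (_ ^+ _).
  by apply: eq_bigr => i _; rewrite natrD natrM -(natr1 i); ring.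
by field.
Qed.

(** In terms of valuations, v(n) / (2n)! has valuation at least
    - 2n / (p+1); this form avoids negative exponents.  By induction, the
    binomial coefficient in each convolution term supplies the part of (2n)!
    that is not in (2m)! (2(n-m))!, and the exponents 2m / (p+1) and
    2(n-m) / (p+1) add up to at most 2n / (p+1). *)
Lemma logn_fact_dvd_vseq (v : nat -> int) (p n : nat) :
  is_vseq v -> prime p -> odd p ->
  ((p ^ logn p (2 * n)`!)%N%:Z %| (p ^ ((2 * n) %/ p.+1))%N%:Z * v n)%Z.
Proof.
move=> hv p_prime p_odd.
have p2 : (2 < p)%N by case: p p_prime p_odd => [|[|[|]]].
elim/ltn_ind: n => -[|n] IH; first by rewrite muln0 fact0 logn1 dvd1z.
(* As p is odd, it is enough to bound 2 * v n. *)
rewrite -(@Gauss_dvdzr _ 2); last first.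
  by rewrite coprimezE /= coprimeXl // coprime_sym coprime2n.
rewrite mulrCA is_vseq_double // mulrBr big_distrr /=; apply: rpredB.
  rewrite -PoszM dvdzE /=.
  apply: dvdn_trans (_ : p ^ ((2 * n.+1) %/ p.+1 + 2 * logn p n.+1`!) %| _)%N.
    apply: dvdn_exp2l; apply: leq_trans (logn_fact_double _ _ p_prime) _.
    by rewrite addnC leq_add2r trunc_log_even_le.
  rewrite expnD dvdn_mul // dvdn_mull // mulnC expnM dvdn_exp2r //.
  apply: dvdn_prod_progression; last exact: pfactor_dvdnn.
  by rewrite (@coprimeXl 2 2) // coprimeXr // coprime2n.
rewrite big_nat_cond; apply: rpred_sum => m /andP[/andP[m0 mn] _].
have mn' : (2 * m <= 2 * n.+1)%N by lia.
rewrite -(bin_fact mn') !lognM ?muln_gt0 ?fact_gt0 ?bin_gt0 //.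
have -> : (2 * n.+1 - 2 * m = 2 * (n.+1 - m))%N by lia.
set a := ((2 * m) %/ p.+1)%N; set b := ((2 * (n.+1 - m)) %/ p.+1)%N.
apply: (@dvdz_trans ((p ^ (a + b))%N%:Z * conv_term v n.+1 m)).
  rewrite /conv_term !expnD !PoszM.
  rewrite (_ : _ * _ * (_ * _ * _) = 'C(2 * n.+1, 2 * m)%:Z *
    ((p ^ a)%N%:Z * v m * ((p ^ b)%N%:Z * v (n.+1 - m)%N))); last by ring.
  apply: dvdz_mul; first by rewrite dvdzE /= pfactor_dvdnn.
  by apply: dvdz_mul; apply: IH; lia.
apply: dvdz_mul => //; rewrite dvdzE /= dvdn_exp2l //.
have -> : (2 * n.+1 = 2 * m + 2 * (n.+1 - m))%N by lia.
by rewrite leq_divRL // mulnDl leq_add // leq_divM.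
Qed.

(** Only the terms k = 1 and k = 2 of Legendre's formula are kept.  If q is the
    quotient of N by p, then p^2 <= N gives q >= p, so that
    N < q * p + p <= q * (p+1) and the quotient of N by p+1 is less than q. *)
Lemma logn_fact_lower (p N : nat) : prime p -> (p ^ 2 <= N)%N ->
  (N %/ p.+1 + N %/ p ^ 2 < logn p N`!)%N.
Proof.
move=> pp pN; have p1 := prime_gt1 pp.
have N2 : (2 <= N)%N by nia.
rewrite (logn_fact _ pp) big_ltn; last by lia.
rewrite big_ltn; last by lia.
rewrite expn1 addnA; apply: leq_trans (leq_addr _ _).
rewrite -addSn leq_add2r ltn_divLR //.
have := divn_eq N p; have := ltn_pmod N (ltnW p1).
have : (p <= N %/ p)%N by rewrite leq_divRL ?prime_gt0 // mulnn.
set r := (N %% _)%N; set q := (N %/ _)%N; rewrite mulnS; lia.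
Qed.

Theorem theorem17 (v : nat -> int) (hv : is_vseq v)
  (p : nat) (p_prime : prime p) (p_odd : odd p) (e : nat) (he : (2 <= e)%N)
  (n : nat)
  (hn : Num.ceil ((e%:R - 1) * p%:R ^+ 2 / 2 : rat) <= n%:Z) :
  ((p ^ e)%N%:Z %| v n)%Z.
Proof.
have eN : ((e - 1) * p ^ 2 <= 2 * n)%N.
  move: hn; rewrite ceil_le_int -pmulrn ler_pdivrMr // mulrC.
  rewrite -(ler_nat rat) 2!natrM natrX natrB ?(ltnW he) //.
  by rewrite mulrC [leRHS]mulrC.
have p0 := prime_gt0 p_prime.
have pN : (p ^ 2 <= 2 * n)%N by nia.
have eq : (e - 1 <= (2 * n) %/ p ^ 2)%N by rewrite leq_divRL // expn_gt0 p0.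
have L := logn_fact_lower _ _ p_prime pN.
have := logn_fact_dvd_vseq v p n hv p_prime p_odd.
set f := ((2 * n) %/ p.+1)%N in L *.
move=> /(dvdz_trans (_ : (p ^ (f + e))%N%:Z %| _)%Z) D.
have {D} : ((p ^ (f + e))%N%:Z %| (p ^ f)%N%:Z * v n)%Z.
  by apply: D; rewrite dvdzE /= dvdn_exp2l //; lia.
by rewrite expnD PoszM dvdz_mul2l // eqz_nat -lt0n expn_gt0 p0.
Qed.
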